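(* Let $(W,T)$ be a finite dual Coxeter system of rank $n$ and $W'$ a reflection subgroup of rank $n-1$. Then $W'$ is a parabolic subgroup if and only if there exists $t\in T$ such that $\langle W',t\rangle=W$.
   Context: A dual Coxeter system $(W,T)$ of (finite) rank $n$ consists of a group $W$ and a subset $T\subseteq W$ such that there is a subset $S\subseteq T$ with $|S|=n$, $(W,S)$ a Coxeter system, and $T=\{wsw^{-1}\mid w\in W, s\in S\}$; it is finite if $W$ is finite. Elements of $T$ are called reflections. A simple system for $(W,T)$ is any subset $S'\subseteq T$ such that $(W,S')$ is a Coxeter system; all simple systems have the same cardinality $n$, the rank of $(W,T)$. A subgroup of $W$ is called parabolic for $(W,T)$ if it is of the form $\langle s_1,\dots,s_m\rangle$ for some simple system $\{s_1,\dots,s_n\}$ for $(W,T)$ and some $m\le n$. A reflection subgroup $W'$ of $W$ is a subgroup generated by elements of $T$; then $(W',W'\cap T)$ is again a dual Coxeter system, and the rank of $W'$ is the rank of $(W',W'\cap T)$. *)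

(* Defs.v *)
From HB Require Import structures.
From mathcomp Require Import all_boot all_fingroup.

Set Implicit Arguments.
Unset Strict Implicit.
Unset Printing Implicit Defensive.

Local Open Scope group_scope.

(* (W, S) is a Coxeter system: S is a set of elements of order 2 generating W,
   and W has the presentation < S | (s t)^m(s, t) = 1 > with m(s, t) the order
   of s * t.  The presentation is given by its universal property among all
   groups, finite or not.  Since W is finite, no m(s, t) is infinite; the
   relations for s = t are (s s)^1 = 1. *)
Definition coxeter_system (gT : finGroupType) (W S : {set gT}) : Prop :=
  [/\ <<S>> = W,
      forall s, s \in S -> #[s] = 2
    & forall (H : groupType) (f : gT -> H),
        (forall s t, s \in S -> t \in S -> (f s * f t) ^+ #[s * t] = 1) ->
        exists2 phi : gT -> H,
          {in W &, {morph phi : x y / x * y}} & {in S, phi =1 f}].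

Definition dual_coxeter_system
    (gT : finGroupType) (W T : {set gT}) (n : nat) : Prop :=
  exists S : {set gT},
    [/\ S \subset T, #|S| = n, coxeter_system W S
      & T = [set w * s * w^-1 | w in W, s in S]].

Definition simple_system (gT : finGroupType) (W T S : {set gT}) : Prop :=
  S \subset T /\ coxeter_system W S.

(* Simple systems are unordered, so an initial segment s_1, ..., s_m of some
   enumeration of S is an arbitrary subset I of S. *)
Definition parabolic (gT : finGroupType) (W T P : {set gT}) : Prop :=
  exists S I : {set gT},
    [/\ simple_system W T S, I \subset S & P = <<I>>].

Definition reflection_subgroup (gT : finGroupType) (T P : {set gT}) : Prop :=
  exists2 R : {set gT}, R \subset T & P = <<R>>.

Definition reflection_subgroup_rank
    (gT : finGroupType) (T P : {set gT}) (k : nat) : Prop :=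
  dual_coxeter_system P (P :&: T) k.

(* Main.v *)
(* The geometric representation makes W a finite group of isometries of a real
   inner product space V of dimension n with no nonzero fixed vector, the members
   of T being the reflections.  By Tits' argument, reflections of W whose unit
   roots lie in an open half-space and meet pairwise at the angles pi - pi/m,
   with m the order of the product, form a Coxeter system for the group that
   they generate.

   If <W', t> = W, then n reflections generate W, so their roots are linearly
   independent.  A set of reflections with roots as above extends as follows by a
   reflection t whose root b has (v, b) <> 0 for some v orthogonal to the given
   roots: among all t' generating the same group together with the given
   reflections, take the one whose root is minimal for (v, .) and then for (p, .),
   where p is positive on the given roots.  Minimality forces the right angles,
   because in a dihedral group a root at the wrong angle can be replaced by a
   smaller one without changing the group.  Applying this to the generators of W'
   and then to t produces a simple system of W that contains one of W'.

   Conversely, n reflections are needed to generate W and n - 1 to generate W',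
   and a sign character shows that every member of S is conjugate to a member of
   any given simple system S'; so |S'| <= n, and a parabolic W' is generated by at
   least n - 1 members of some S'. *)
Require Import Defs.
From HB Require Import structures.
From mathcomp Require Import all_boot all_order all_fingroup all_algebra cyclic.
From mathcomp Require Import ring lra.
From mathcomp Require Import boolp Rstruct reals trigo.

Set Implicit Arguments.
Unset Strict Implicit.
Unset Printing Implicit Defensive.

Import Order.TTheory GRing.Theory Num.Theory.

Local Open Scope ring_scope.

(** * Sines of the multiples of pi / m *)

Section Trigonometry.
Variable R : realType.
Implicit Types x y : R.

Lemma sinDnpi (k : nat) x : sin (x + k%:R * pi) = (-1) ^+ k * sin x.
Proof. by rewrite mulr_natl (alternatingn (@sinDpi R)). Qed.

Lemma sin_eq0_ge0 x : 0 <= x -> sin x = 0 -> exists k : nat, x = k%:R * pi.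
Proof.
move=> x0 sx0; have pi0 := pi_gt0 R; pose k := Num.truncn (x / pi).
have /andP[kx xk] := truncn_itv (divr_ge0 x0 (ltW pi0)).
rewrite ler_pdivlMr// in kx; rewrite ltr_pdivrMr// in xk.
exists k; have [// | x_neq] := eqVneq x (k%:R * pi).
have: 0 < sin (x - k%:R * pi).
  rewrite sin_gt0_pi// subr_gt0 lt_neqAle eq_sym x_neq kx /=.
  by move: xk; rewrite -/k -natr1; lra.
move=> h; have := sinDnpi k (x - k%:R * pi).
by rewrite subrK sx0 => /esym/eqP; rewrite mulf_eq0 signr_eq0 (gt_eqF h).
Qed.

(** In product form the difference has two nonnegative factors, because [(j + 1) * t <= pi]. The
    bound yields the coefficient [x >= 1] in [dihedral_step]. *)
Lemma sin_natpi_ge (m j : nat) : (0 < j < m)%N ->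
  sin (pi / m%:R) <= sin (j%:R * (pi / m%:R)) :> R.
Proof.
move=> /andP[j0 jm]; have pi0 := pi_gt0 R.
have m0 : 0 < m%:R :> R by rewrite ltr0n (leq_ltn_trans _ jm).
set t := pi / m%:R; have t0 : 0 < t by rewrite divr_gt0.
have mt : m%:R * t = pi by rewrite mulrCA divff ?mulr1 ?gt_eqF.
have j1 : 1 <= j%:R :> R by rewrite ler1n.
have jm1 : j%:R + 1 <= m%:R :> R by rewrite natr1 ler_nat.
rewrite -subr_ge0.
have -> : sin (j%:R * t) - sin t =
    2 * (sin ((j%:R - 1) * t / 2) * cos ((j%:R + 1) * t / 2)).
  set u := (j%:R - 1) * t / 2; set v := (j%:R + 1) * t / 2.
  have -> : j%:R * t = v + u by rewrite /u /v; lra.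
  have -> : t = v - u by rewrite /u /v; lra.
  by rewrite sinD sinB; ring.
have h : (j%:R + 1) * t <= pi by rewrite -mt ler_pM2r.
have h' : 0 <= (j%:R - 1) * t by apply: mulr_ge0; [rewrite subr_ge0|exact: ltW].
apply: mulr_ge0 => //; apply: mulr_ge0; first by apply: sin_ge0_pi; nra.
by apply: cos_ge0_pihalf; lra.
Qed.

Lemma sin_natpi_gt0 (m j : nat) : (0 < j < m)%N ->
  0 < sin (j%:R * (pi / m%:R)) :> R.
Proof.
move=> /andP[j0 jm]; have pi0 := pi_gt0 R.
have m0 : 0 < m%:R :> R by rewrite ltr0n (leq_ltn_trans _ jm).
have t0 : 0 < pi / m%:R :> R by rewrite divr_gt0.
rewrite sin_gt0_pi// mulr_gt0 ?ltr0n//=.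
have {2}-> : pi = m%:R * (pi / m%:R) :> R by rewrite mulrCA divff ?mulr1 ?gt_eqF.
by rewrite ltr_pM2r// ltr_nat.
Qed.

End Trigonometry.

(** * Reflections and dihedral planes *)

(** Positivity is kept apart: Tits' argument is also run on [cox_form], for which only symmetry and
    bilinearity are at hand. *)
Record sym_bilinear (R : realType) (V : lmodType R) (dot : V -> V -> R) : Prop :=
  SymBilinear {
    dotC : forall x y, dot x y = dot y x;
    dotPl : forall c x y z, dot (c *: x + y) z = c * dot x z + dot y z
  }.

Record inner_product (R : realType) (V : lmodType R) (dot : V -> V -> R) : Prop :=
  InnerProduct {
    inner_bilinear :> sym_bilinear dot;
    dot_gt0 : forall x, x != 0 -> 0 < dot x x
  }.

Definition hrefl (R : realType) (V : lmodType R) (dot : V -> V -> R) (a x : V) : V :=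
  x - (2 * dot x a) *: a.

Section Bilinear.
Variables (R : realType) (V : lmodType R) (dot : V -> V -> R).
Hypothesis ip : sym_bilinear dot.
Implicit Types (a b x y z : V) (c psi phi : R).
Local Notation hrefl := (hrefl dot).

Lemma dot0l x : dot 0 x = 0.
Proof. by have := dotPl ip 1 0 0 x; rewrite scale1r mul1r addr0 => ?; lra. Qed.

Lemma dotDl x y z : dot (x + y) z = dot x z + dot y z.
Proof. by rewrite -[x]scale1r (dotPl ip) mul1r scale1r. Qed.

Lemma dotZl c x z : dot (c *: x) z = c * dot x z.
Proof. by rewrite -[c *: x]addr0 (dotPl ip) dot0l addr0. Qed.

Lemma dotNl x z : dot (- x) z = - dot x z.
Proof. by rewrite -scaleN1r dotZl mulN1r. Qed.

Lemma dotDr x y z : dot z (x + y) = dot z x + dot z y.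
Proof. by rewrite !(dotC ip z) dotDl. Qed.

Lemma dotZr c x z : dot z (c *: x) = c * dot z x.
Proof. by rewrite !(dotC ip z) dotZl. Qed.

Lemma dotNr x z : dot z (- x) = - dot z x.
Proof. by rewrite !(dotC ip z) dotNl. Qed.

Definition dotE := (dotDl, dotDr, dotNl, dotNr, dotZl, dotZr).

Lemma unit_neq0 a : dot a a = 1 -> a != 0.
Proof. by apply: contra_eq_neq => ->; rewrite dot0l eq_sym oner_neq0. Qed.

Lemma hrefl_linear a c x y : hrefl a (c *: x + y) = c *: hrefl a x + hrefl a y.
Proof.
rewrite /hrefl dotDl dotZl scalerBr scalerA mulrDr scalerDl opprD addrACA.
by rewrite mulrCA.
Qed.

Lemma hrefl_dot a x y : dot a a = 1 -> dot (hrefl a x) (hrefl a y) = dot x y.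
Proof. by move=> aa; rewrite /hrefl !dotE aa (dotC ip a y); ring. Qed.

Lemma hrefl_self a : dot a a = 1 -> hrefl a a = - a.
Proof. by move=> aa; rewrite /hrefl aa mulr1 scaler_nat mulr2n opprD addNKr. Qed.

Lemma hreflK a : dot a a = 1 -> involutive (hrefl a).
Proof.
move=> aa x; rewrite /hrefl !dotE aa -addrA -opprD -scalerDl.
have -> : 2 * dot x a + 2 * (dot x a - 2 * dot x a * 1) = 0 by ring.
by rewrite scale0r subr0.
Qed.

Lemma hreflN a x : hrefl (- a) x = hrefl a x.
Proof. by rewrite /hrefl dotNr mulrN scaleNr scalerN opprK. Qed.

Lemma hrefl_id a x : dot a a = 1 -> hrefl a x = x <-> dot x a = 0.
Proof.
move=> aa; split=> [e|e]; last by rewrite /hrefl e mulr0 scale0r subr0.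
have := hrefl_dot x a aa; rewrite hrefl_self// e dotNr => ?; lra.
Qed.

(** For independent unit vectors of a Euclidean plane with [dot a b = - cos psi], this is [sin psi]
    times the unit vector at angle [phi] from [a], measured towards [b]. *)
Definition dvec psi a b phi : V := sin (phi + psi) *: a + sin phi *: b.

(** Measuring the angle from the other vector absorbs the change of orientation, so a reflection
    becomes a shift by [psi]. *)
Lemma hrefl_dvec psi a b phi : dot b b = 1 -> dot a b = - cos psi ->
  hrefl b (dvec psi a b phi) = dvec psi b a (phi + psi).
Proof.
move=> bb ab; rewrite /hrefl /dvec !dotE bb ab -addrA addrC; congr (_ + _).
rewrite -scalerBl; congr (_ *: _).
have := congr1 ( *%R (sin phi)) (cos2Dsin2 psi); rewrite !sinD !cosD.
lra.
Qed.

Lemma dvec0 psi a b : dvec psi a b 0 = sin psi *: a.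
Proof. by rewrite /dvec add0r sin0 scale0r addr0. Qed.

Lemma dvecD2pi psi a b phi k :
  dvec psi a b (phi + (k%:R * pi) *+ 2) = dvec psi a b phi.
Proof.
have sinD2 (u : R) : sin (u + (k%:R * pi) *+ 2) = sin u.
  by rewrite mulr2n addrA !sinDnpi mulrA -exprMn mulrNN mul1r expr1n mul1r.
by rewrite /dvec addrAC !sinD2.
Qed.

Lemma iter_hrefl_dvec psi a b phi k : dot a a = 1 -> dot b b = 1 ->
  dot a b = - cos psi ->
  iter k (fun x => hrefl a (hrefl b x)) (dvec psi a b phi) =
  dvec psi a b (phi + (k%:R * psi) *+ 2).
Proof.
move=> aa bb ab; elim: k => [|k IHk]; first by rewrite mul0r mul0rn addr0.
rewrite iterS IHk !hrefl_dvec 1?(dotC ip b)//; congr dvec.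
by rewrite -natr1; ring.
Qed.

(* Both reflections fix the orthogonal complement of the plane of [a] and [b],
   and [dvec] parametrises that plane. *)
Lemma iter_hrefl_id psi a b k j x : dot a a = 1 -> dot b b = 1 ->
  dot a b = - cos psi -> sin psi != 0 -> k%:R * psi = j%:R * pi ->
  iter k (fun x => hrefl a (hrefl b x)) x = x.
Proof.
move=> aa bb ab s0 kj; set f := fun _ => _.
have fP n c y z : iter n f (c *: y + z) = c *: iter n f y + iter n f z.
  by elim: n => //= n ->; rewrite /f !hrefl_linear.
have f_dvec phi : iter k f (dvec psi a b phi) = dvec psi a b phi.
  by rewrite iter_hrefl_dvec// kj dvecD2pi.
have h0 (d : V) : hrefl d 0 = 0 by rewrite /hrefl dot0l mulr0 scale0r subr0.
have f0 n : iter n f 0 = 0 by elim: n => //= n ->; rewrite /f !h0.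
have fZ c y : iter k f (c *: y) = c *: iter k f y.
  by rewrite -[c *: y]addr0 fP f0 addr0.
have fa : iter k f a = a.
  apply: (scalerI s0); rewrite -fZ.
  by have := f_dvec 0; rewrite dvec0.
have fb : iter k f b = b.
  have := f_dvec (- psi); rewrite /dvec addNr sin0 scale0r add0r sinN fZ.
  by move/(scalerI (_ : - sin psi != 0)); apply; rewrite oppr_eq0.
pose g := dot a b; pose A := dot x a; pose B := dot x b.
(* [u] and [w] below solve the Gram system of [a] and [b], of determinant [1 - g ^+ 2], so [z] is
   orthogonal to both. *)
have s2 : 1 - g ^+ 2 != 0 by rewrite /g ab sqrrN -sin2cos2 expf_neq0.
pose u := (A - g * B) / (1 - g ^+ 2); pose w := (B - g * A) / (1 - g ^+ 2).
pose z := x - (u *: a + w *: b).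
have za : dot z a = 0.
  rewrite /z dotDl dotNl dotDl !dotZl aa (dotC ip b a) -/g -/A /u /w; field.
  exact: s2.
have zb : dot z b = 0.
  rewrite /z dotDl dotNl dotDl !dotZl bb -/g -/B /u /w; field.
  exact: s2.
have fz n : iter n f z = z.
  by elim: n => //= n ->; rewrite /f /hrefl zb mulr0 scale0r subr0 za mulr0 scale0r subr0.
have -> : x = u *: a + (w *: b + z) by rewrite addrA addrC subrK.
by rewrite !fP fa fb fz.
Qed.

End Bilinear.

Fixpoint alt (I : Type) (k : nat) (i j : I) : seq I :=
  if k is k'.+1 then i :: alt k' j i else [::].

Lemma size_alt (I : Type) k (i j : I) : size (alt k i j) = k.
Proof. by elim: k i j => //= k IHk i j; rewrite IHk. Qed.

Lemma alt_cat (I : Type) k l (i j : I) : alt (k + l) i j =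
  alt k i j ++ (if odd k then alt l j i else alt l i j).
Proof.
elim: k i j => //= k IHk i j; congr cons; rewrite IHk.
by case: (odd k).
Qed.

(** * Tits' argument for words acting trivially *)

(** Kept abstract so that it can be equality of products in one group or in two groups at once. *)
Record coxeter_congruence (I : eqType) (m : I -> I -> nat)
    (E : seq I -> seq I -> Prop) : Prop := CoxeterCongruence {
  cox_refl : forall w, E w w;
  cox_sym : forall w w', E w w' -> E w' w;
  cox_trans : forall w w' w'', E w w' -> E w' w'' -> E w w'';
  cox_cat : forall u u' w w', E u u' -> E w w' -> E (u ++ w) (u' ++ w');
  cox_inv : forall i, E [:: i; i] [::];
  cox_braid : forall i j, i != j -> E (alt (m i j).*2 i j) [::]
}.

Section Tits.
Variables (R : realType) (V : lmodType R) (dot : V -> V -> R).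
Hypothesis ip : sym_bilinear dot.
Variables (I : eqType) (a : I -> V) (m : I -> I -> nat) (lam : V -> R).
Hypothesis a_unit : forall i, dot (a i) (a i) = 1.
Hypothesis m_gt1 : forall i j, i != j -> (1 < m i j)%N.
Hypothesis a_dot :
  forall i j, i != j -> dot (a i) (a j) = - cos (pi / (m i j)%:R).
Hypothesis lam_linear : forall c x y, lam (c *: x + y) = c * lam x + lam y.
Hypothesis lam_gt0 : forall i, 0 < lam (a i).

Definition wact (x : V) (w : seq I) : V :=
  foldl (fun y i => hrefl dot (a i) y) x w.

Lemma wact_linear c x y w :
  wact (c *: x + y) w = c *: wact x w + wact y w.
Proof.
by elim: w x y => //= i w IHw x y; rewrite -IHw (hrefl_linear ip).
Qed.

Lemma wact0 w : wact 0 w = 0.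
Proof.
have := wact_linear 1 0 0 w; rewrite !scale1r !addr0 => h.
by apply: (addrI (wact 0 w)); rewrite addr0.
Qed.

Lemma wactZ c x w : wact (c *: x) w = c *: wact x w.
Proof. by have := wact_linear c x 0 w; rewrite wact0 !addr0. Qed.

Lemma lamZ c x : lam (c *: x) = c * lam x.
Proof.
have := lam_linear c x 0; have := lam_linear 1 0 0.
by rewrite !scale1r mul1r !addr0 => ? ->; lra.
Qed.

Lemma wact_cat x u w : wact x (u ++ w) = wact (wact x u) w.
Proof. exact: foldl_cat. Qed.

Lemma wact_dvec i j psi phi k : dot (a i) (a j) = - cos psi ->
  wact (dvec psi (a i) (a j) phi) (alt k j i) =
  if odd k then dvec psi (a j) (a i) (phi + k%:R * psi)
  else dvec psi (a i) (a j) (phi + k%:R * psi).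
Proof.
elim: k i j phi => [|k IHk] i j phi ij /=; first by rewrite mul0r addr0.
rewrite (hrefl_dvec ip)// IHk 1?(dotC ip)// -addrA.
have -> : psi + k%:R * psi = k.+1%:R * psi by rewrite -natr1 mulrDl mul1r addrC.
by case: (odd k).
Qed.

Variable E : seq I -> seq I -> Prop.
Hypothesis coxE : coxeter_congruence m E.
Hypothesis E_act : forall w w', E w w' -> forall x, wact x w = wact x w'.

Definition reduced w := forall w', E w w' -> (size w <= size w')%N.

Lemma cox_catl u w w' : E w w' -> E (u ++ w) (u ++ w').
Proof. by move=> ?; apply: (cox_cat coxE) => //; apply: (cox_refl coxE _). Qed.

Lemma cox_catr u u' w : E u u' -> E (u ++ w) (u' ++ w).
Proof. by move=> ?; apply: (cox_cat coxE) => //; apply: (cox_refl coxE _). Qed.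

Lemma cox_cons2 i w : E (i :: i :: w) w.
Proof. exact: (cox_catr w (cox_inv coxE i)). Qed.

Lemma cox_rev w : E (w ++ rev w) [::].
Proof.
elim: w => [|i w IHw]; first exact: (cox_refl coxE _).
rewrite rev_cons -cats1 catA /=.
apply: (cox_trans coxE _ (cox_inv coxE i)).
exact: (cox_catl [:: i] (cox_catr [:: i] IHw)).
Qed.

Lemma exists_reduced w : exists2 w', E w w' & reduced w'.
Proof.
have [n] := ubnP (size w); elim: n w => // n IHn w /ltnSE wn.
have [wr|] := pselect (reduced w); first by exists w => //; apply: (cox_refl coxE _).
move=> /existsNP[w' /not_implyP[ww' /negP]]; rewrite -ltnNge => lt_w'w.
have [w'' ww'' rw''] := IHn w' (leq_trans lt_w'w wn).
by exists w'' => //; apply: (cox_trans coxE ww' ww'').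
Qed.

Lemma cox_alt_rcons k i j z : (0 < k)%N -> z = i \/ z = j ->
  rcons (alt k i j) z = alt k.+1 i j \/ E (rcons (alt k i j) z) (alt k.-1 i j).
Proof.
elim: k i j => // -[|k] IHk i j _ zij.
  by case: zij => ->; [right; apply: (cox_inv coxE _) | left].
have zji : z = j \/ z = i by tauto.
case: (IHk j i isT zji) => [e|h]; first by left; exact: (congr1 (cons i) e).
right.
exact: (cox_catl [:: i] h).
Qed.

(** The braid word of length [2 m] splits after [m + 1] letters; the prefix is then equivalent to
    the reversal of the remaining [m - 1] letters. *)
Lemma cox_alt_shorter i j : i != j ->
  exists2 u, E (alt (m i j).+1 i j) u & (size u < m i j)%N.
Proof.
move=> ij; have := m_gt1 ij; have := cox_braid coxE ij; set n := m i j => braid n1.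
have nn : n.*2 = (n.+1 + n.-1)%N by rewrite addSnnS prednK ?addnn// ltnW.
move: braid; rewrite nn alt_cat; set z := if _ then _ else _ => braid.
have sz : size z = n.-1 by rewrite /z; case: ifP; rewrite size_alt.
exists (rev z); last by rewrite size_rev sz prednK// ltnW.
have h1 := cox_catl (alt n.+1 i j) (cox_rev z); rewrite cats0 catA in h1.
exact: (cox_trans coxE (cox_sym coxE h1) (cox_catr (rev z) braid)).
Qed.

(* Writing [w] as [alt k r s ++ v] with [r] the first letter of [w] and [k] maximal,
   the positivity for [r :: v] and [s :: v] passes to [s :: w], as [alt k r s] maps
   the root of [s] to a nonnegative combination of those of [r] and [s]. *)
Lemma tits_positive w s : reduced w ->
  (forall w', E (s :: w) w' -> (size w <= size w')%N) -> 0 < lam (wact (a s) w).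
Proof.
have [n] := ubnP (size w); elim: n w s => // n IHn [|r w1] s; first by move=> *; apply: lam_gt0.
set w := r :: w1 => /ltnSE wn wr sw.
have sr : s != r.
  apply/eqP => sr; have := sw w1; rewrite ltnn => h.
  by have := h _; rewrite /w -sr => /(_ (cox_cons2 _ _)).
pose P k := exists2 v, (k + size v = size w)%N &
  E w (alt k r s ++ v) \/ E w (alt k s r ++ v).
have P1 : exists k, `[< P k >].
  by exists 1%N; apply/asboolP; exists w1 => //; left; apply: (cox_refl coxE _).
have Pmax k : `[< P k >] -> (k <= size w)%N.
  by move=> /asboolP[v <- _]; rewrite leq_addr.
have [k /asboolP[v kv wv] kmax] := ex_maxnP P1 Pmax.
have k0 : (0 < k)%N.
  by apply: kmax; apply/asboolP; exists w1 => //; left; apply: (cox_refl coxE _).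
have vlt : (size v < size w)%N by rewrite -kv -[ltnLHS]add0n ltn_add2r.
(* A word for [w] of the same length beginning with [s] would cancel against the [s] of [s :: w] and
   leave a word shorter than [w]. *)
have {}wv : E w (alt k r s ++ v).
  case: wv => // wv; have := sw (alt k.-1 r s ++ v).
  rewrite size_cat size_alt -kv leq_add2r leqNgt prednK// leqnn => h.
  suff: false by []; apply: h.
  apply: (cox_trans coxE (cox_catl [:: s] wv) _).
  by rewrite -{1}(prednK k0) /=; apply: cox_cons2.
have vr : reduced v.
  move=> v' vv'; have := wr (alt k r s ++ v').
  rewrite size_cat size_alt -kv leq_add2l; apply.
  exact: (cox_trans coxE wv (cox_catl _ vv')).
(* A shorter word for [z :: v] would either lengthen the alternating prefix, against the maximality
   of [k], or shorten [w]. *)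
have zv z : z = r \/ z = s -> forall v', E (z :: v) v' -> (size v <= size v')%N.
  move=> zrs v' zvv'; rewrite leqNgt; apply/negP => v'v.
  have wz : E w (rcons (alt k r s) z ++ v').
    apply: (cox_trans coxE wv _); rewrite cat_rcons; apply: cox_catl.
    apply: (cox_trans coxE (cox_sym coxE (cox_cons2 z v)) _).
    exact: (cox_catl [:: z] zvv').
  case: (cox_alt_rcons k0 zrs) => [e|e].
    rewrite e in wz; have := wr _ wz; rewrite size_cat size_alt -kv => le_v'.
    have : (k < k)%N; last by rewrite ltnn.
    apply: kmax; apply/asboolP; exists v'; last by left.
    by apply/eqP; rewrite -kv eqn_leq le_v' andbT addSnnS leq_add2l.
  have := wr _ (cox_trans coxE wz (cox_catr v' e)).
  rewrite size_cat size_alt -kv => h.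
  have := leq_trans h (leq_add (leq_pred k) (leqnn _)).
  by rewrite leq_add2l leqNgt v'v.
have vn : (size v < n)%N by rewrite (leq_trans vlt).
have lamr := IHn _ r vn vr (zv r (or_introl erefl)).
have lams := IHn _ s vn vr (zv s (or_intror erefl)).
(* Otherwise [s] and the prefix form an alternating word of more than [m s r] letters, and
   shortening it makes [s :: w] equivalent to a word shorter than [w]. *)
have km : (k < m s r)%N.
  rewrite ltnNge; apply/negP => mk.
  have [u su um] := cox_alt_shorter sr.
  have := cox_catl [:: s] wv; rewrite -(subnKC mk) alt_cat.
  set z := if _ then _ else _; rewrite -catA => h.
  have /sw : E (s :: w) (u ++ z ++ v).
    by apply: (cox_trans coxE h _); apply: (cox_catr (z ++ v) su).
  rewrite !size_cat -kv addnA leq_add2r.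
  have -> : size z = (k - m s r)%N by rewrite /z; case: ifP; rewrite size_alt.
  by rewrite leqNgt -{2}(subnKC mk) ltn_add2r um.
have psi0 : 0 < sin (pi / (m s r)%:R) :> R.
  by have := @sin_natpi_gt0 R (m s r) 1; rewrite mul1r; apply; rewrite m_gt1.
(* Scaled by this sine, [a s] is [dvec] at angle 0, on which [wact_dvec] evaluates the alternating
   prefix. *)
rewrite -(pmulr_rgt0 _ psi0).
rewrite -lamZ (E_act wv) wact_cat.
rewrite -!wactZ.
have -> : sin (pi / (m s r)%:R) *: a s = dvec (pi / (m s r)%:R) (a s) (a r) 0.
  by rewrite /dvec add0r sin0 scale0r addr0.
rewrite wact_dvec ?a_dot// add0r /dvec -[X in sin (_ + X)]mul1r -mulrDl natr1.
have sk : 0 < sin (k%:R * (pi / (m s r)%:R)) :> R by apply: sin_natpi_gt0; rewrite k0.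
(* This coefficient vanishes when [k.+1 = m s r]; strict positivity of the sum comes from [sk]. *)
have sk1 : 0 <= sin (k.+1%:R * (pi / (m s r)%:R)) :> R.
  have : (k.+1 < m s r)%N || (k.+1 == m s r) by rewrite orbC -leq_eqVlt.
  case/orP => [km1|/eqP km1]; first by apply/ltW/sin_natpi_gt0.
  by rewrite km1 mulrCA divff ?mulr1 ?sinpi// pnatr_eq0 -lt0n -km1.
have lamD c1 x1 c2 x2 : lam (wact (c1 *: x1 + c2 *: x2) v) =
    c1 * lam (wact x1 v) + c2 * lam (wact x2 v).
  by rewrite wact_linear lam_linear wactZ lamZ.
case: (odd k); rewrite lamD ltr_wpDl// ?mulr_gt0// mulr_ge0// ltW//.
Qed.

(** If a nonempty reduced word [s :: u] acted trivially, [u] would send [a s] to [- a s], against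
    [tits_positive]. *)
Theorem tits w : (forall x, wact x w = x) -> E w [::].
Proof.
move=> w1; have [[//|s u] wu ru] := exists_reduced w.
have wact_su x : wact x (s :: u) = x by rewrite -(E_act wu).
have ur : reduced u.
  by move=> u' uu'; have := ru (s :: u') (cox_catl [:: s] uu').
have : 0 < lam (wact (a s) u).
  by apply: tits_positive => // u' /ru /ltnW.
have := wact_su (a s); rewrite /= (hrefl_self (a_unit s)) => e.
have -> : wact (a s) u = -1 *: a s.
  by rewrite -[in RHS]e -wactZ scaleN1r opprK.
by rewrite lamZ; have := lam_gt0 s; lra.
Qed.

End Tits.

(** * Finite reflection representations *)

(** A right action, constrained only on [W]. By [rep_fix0], the roots of reflections generating [W]
    span the space. *)
Record reflection_rep (gT : finGroupType) (W : {set gT}) (R : realType)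
    (V : lmodType R) (dot : V -> V -> R) (act : V -> gT -> V) : Prop :=
  ReflectionRep {
    rep_linear : forall w, w \in W ->
      forall c x y, act (c *: x + y) w = c *: act x w + act y w;
    rep1 : forall x, act x 1%g = x;
    repM : {in W &, forall w u x, act x (w * u)%g = act (act x w) u};
    rep_dot : forall w, w \in W -> forall x y, dot (act x w) (act y w) = dot x y;
    rep_faithful : forall w, w \in W -> (forall x, act x w = x) -> w = 1%g;
    rep_fix0 : forall x, (forall w, w \in W -> act x w = x) -> x = 0
  }.

Definition root (gT : finGroupType) (R : realType) (V : lmodType R)
    (dot : V -> V -> R) (act : V -> gT -> V) (t : gT) (a : V) : Prop :=
  dot a a = 1 /\ forall x, act x t = hrefl dot a x.

Section Reflections.
Variables (gT : finGroupType) (W : {group gT}) (R : realType) (V : lmodType R).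
Variables (dot : V -> V -> R) (act : V -> gT -> V).
Hypotheses (ip : inner_product dot) (rep : reflection_rep W dot act).
Local Notation root := (root dot act).
Implicit Types (s t w : gT) (a b c v x y : V).

Lemma rootN t a : root t a -> root t (- a).
Proof.
case=> aa ta; split=> [|x]; first by rewrite !(dotE ip) opprK.
by rewrite (hreflN ip) ta.
Qed.

Lemma root_conj t w a : t \in W -> w \in W -> root t a -> root (t ^ w)%g (act a w).
Proof.
move=> tW wW [aa ta]; split=> [|x]; first by rewrite (rep_dot rep).
have wVW : w^-1%g \in W by rewrite groupV.
set y := act x w^-1%g.
have yw : act y w = x by rewrite -(repM rep)// mulVg (rep1 rep).
rewrite conjgE !(repM rep) ?groupM// -/y ta /hrefl.
rewrite addrC -scaleNr (rep_linear rep)// yw scaleNr addrC.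
by rewrite -[in RHS]yw (rep_dot rep) // yw.
Qed.

Lemma root_inj s t a : s \in W -> t \in W -> root s a -> root t a -> s = t.
Proof.
move=> sW tW [aa sa] [_ ta]; apply/eqP; rewrite eq_mulgV1; apply/eqP.
apply: (rep_faithful rep) => [|x]; first by rewrite groupM ?groupV.
have tV y : act y t^-1 = hrefl dot a y.
  by rewrite -[in LHS](hreflK ip aa y) -ta -(repM rep) ?groupV// mulgV (rep1 rep).
by rewrite (repM rep) ?groupV// sa tV (hreflK ip aa).
Qed.

Lemma root_pm t a b : root t a -> root t b -> a = b \/ a = - b.
Proof.
move=> [aa ta] [bb tb]; have := ta a; rewrite tb hrefl_self// /hrefl => e.
have {e}ab : a = dot a b *: b.
  apply: (scalerI (_ : (2 : R) != 0)); first by rewrite pnatr_eq0.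
  by rewrite scalerA -[RHS](subKr a) e opprK -mulr2n scaler_nat.
have : dot a b ^+ 2 = 1.
  by rewrite expr2 {2}(dotC ip) -(dotZl ip) -ab.
move/eqP; rewrite sqrf_eq1 => /orP[]/eqP c1; rewrite c1 in ab.
  by left; rewrite ab scale1r.
by right; rewrite ab scaleN1r.
Qed.

Lemma root_fix t a v : root t a -> act v t = v <-> dot v a = 0.
Proof. by case=> aa ta; rewrite ta; exact: (hrefl_id ip v aa). Qed.

Lemma fix_gen (A : {set gT}) v : A \subset W ->
  (forall w, w \in A -> act v w = v) -> forall w, w \in <<A>>%g -> act v w = v.
Proof.
move=> AW Av; pose F := [set w in W | `[< act v w = v >]].
have Fgrp : group_set F.
  apply/group_setP; split; first by rewrite inE group1; apply/asboolP/(rep1 rep).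
  move=> w u; rewrite !inE => /andP[wW /asboolP wv] /andP[uW /asboolP uv].
  by rewrite groupM//; apply/asboolP; rewrite (repM rep)// wv.
have AF : A \subset Group Fgrp.
  apply/subsetP => w wA; rewrite inE (subsetP AW)//; exact/asboolP/Av.
by rewrite -gen_subG in AF => w /(subsetP AF); rewrite inE => /andP[_ /asboolP].
Qed.

Variable T : {set gT}.
Hypotheses (TW : T \subset W) (TJ : {in T & W, forall t w, (t ^ w)%g \in T}).

(** Conjugation by [s] advances the angle by [psi] and exchanges the two generators, so the
    induction swaps [s] and [t]. *)
Lemma dihedral_root psi k s t a b : s \in T -> t \in T -> root s a -> root t b ->
  dot a b = - cos psi -> sin psi != 0 ->
  exists2 z, z \in T :&: <<[set s; t]>>%g &
    root z ((sin psi)^-1 *: dvec psi a b (k%:R * psi)).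
Proof.
move=> + + + + + s0; elim: k s t a b => [|k IHk] s t a b sT tT sa tb ab.
  exists s; first by rewrite inE sT mem_gen// set21.
  by rewrite mul0r dvec0 scalerA mulVf// scale1r.
have ba : dot b a = - cos psi by rewrite (dotC ip).
have [z] := IHk t s b a tT sT tb sa ba; rewrite setUC inE => /andP[zT zst] zr.
have sG : s \in <<[set s; t]>>%g by rewrite mem_gen// set21.
have sW := subsetP TW _ sT.
exists (z ^ s)%g; first by rewrite inE TJ// groupJ.
have := root_conj (subsetP TW _ zT) sW zr; case: sa => aa sa.
rewrite sa -[X in hrefl dot a X]addr0 (hrefl_linear ip).
rewrite [X in _ + X](_ : _ = 0) ?addr0; last first.
  by rewrite /hrefl (dot0l ip) mulr0 scale0r subr0.
rewrite (hrefl_dvec ip)// -natr1 mulrDl mul1r; exact.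
Qed.

(** The product acts on the plane of the roots as a rotation by [2 psi], so its order times [psi] is
    a multiple of [pi]. A common factor of [j] and the order would make a smaller power act
    trivially. *)
Lemma root_natpi s t a b psi : s \in T -> t \in T -> root s a -> root t b ->
  dot a b = - cos psi -> 0 < psi < pi ->
  exists j : nat, [/\ (0 < j < #[s * t]%g)%N, coprime j #[s * t]%g &
    #[s * t]%g%:R * psi = j%:R * pi].
Proof.
move=> sT tT sa tb ab /andP[psi0 psipi].
have s0 : 0 < sin psi by rewrite sin_gt0_pi// psi0.
have sW := subsetP TW _ sT; have tW := subsetP TW _ tT.
have actX k x : act x ((t * s) ^+ k)%g = iter k (fun x => hrefl dot a (hrefl dot b x)) x.
  elim: k => [|k IHk]; first by rewrite expg0 (rep1 rep).
  by rewrite expgSr !(repM rep) ?groupX ?groupM// IHk (tb.2 _) (sa.2 _).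
have -> : #[s * t]%g = #[t * s]%g.
  by rewrite -(orderJ (t * s)%g t) conjgE !mulgA mulVg mul1g.
have [aa _] := sa; have [bb _] := tb.
set m := #[t * s]%g; have m0 : (0 < m)%N by apply: order_gt0.
have dvec_m phi : dvec psi a b (phi + (m%:R * psi) *+ 2) = dvec psi a b phi.
  by rewrite -(iter_hrefl_dvec ip)// -actX expg_order (rep1 rep).
have cos1 : cos ((m%:R * psi) *+ 2) = 1 :> R.
  have := congr1 (dot^~ a) (dvec_m 0); rewrite add0r dvec0 /dvec !(dotE ip) aa (dotC ip b) ab.
  rewrite !mulr1 sinD => h; apply: (mulIf (lt0r_neq0 s0)).
  by rewrite mul1r -[RHS]h; ring.
have smpsi : sin (m%:R * psi) = 0.
  apply/eqP; rewrite -sqrf_eq0 sin2cos2; apply/eqP.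
  by move: cos1; rewrite cos_mulr2n; lra.
have mR : 0 < m%:R :> R by rewrite ltr0n.
have [j mj] := sin_eq0_ge0 (ltW (mulr_gt0 mR psi0)) smpsi.
have pi0 := pi_gt0 R.
have jm : (0 < j < m)%N.
  rewrite -(@ltr0n R) -(@ltr_nat R) -(@pmulr_lgt0 R pi)// -mj mulr_gt0//=.
  by rewrite -(ltr_pM2r pi0) -mj ltr_pM2l.
exists j; split => //; rewrite /coprime; set d := gcdn j m.
have d0 : (0 < d)%N by rewrite gcdn_gt0 m0 orbT.
have kj : (m %/ d)%:R * psi = (j %/ d)%:R * pi.
  have dR : d%:R != 0 :> R by rewrite pnatr_eq0 -lt0n.
  by apply: (mulfI dR); rewrite !mulrA -!natrM ![(d * _)%N]mulnC !divnK ?dvdn_gcdl ?dvdn_gcdr.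
have : ((t * s) ^+ (m %/ d))%g = 1%g.
  apply: (rep_faithful rep) => [|x]; first by rewrite groupX ?groupM.
  by rewrite actX (iter_hrefl_id ip x aa bb ab (lt0r_neq0 s0) kj).
move/eqP; rewrite -order_dvdn -/m => /dvdn_leq.
rewrite divn_gt0// dvdn_leq ?dvdn_gcdr// => /(_ isT).
by rewrite leq_divRL ?dvdn_gcdr// -[leqRHS]muln1 leq_pmul2l// eqn_leq d0 andbT.
Qed.

(** The roots are at angle [pi - j * th] with [th = pi / m]. If [j] is not 1, the root [c] at angle
    [pi - th] from [a] on the side of [b] replaces [b]. Since [v] is orthogonal to [a], [dot v b] is
    [x] times [dot v c]. *)
Lemma dihedral_step s t a b v : s \in T -> t \in T -> root s a -> root t b ->
  dot v a = 0 -> dot v b != 0 ->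
  dot b a = - cos (pi / #[s * t]%g%:R) \/
  exists t' c (x y : R), [/\ t' \in T, root t' c, t' \in <<[set s; t]>>%g,
    t \in <<[set s; t']>>%g & b = x *: c + y *: a /\ (1 <= x /\ 0 < y)].
Proof.
move=> sT tT sa tb va vb; have [[aa _] [bb _]] := (sa, tb).
set g := dot a b.
have g2 : g ^+ 2 < 1.
  have : 0 < dot (b - g *: a) (b - g *: a).
    (* If [b] were a multiple of [a], then [v] would be orthogonal to it. *)
    apply: (dot_gt0 ip); apply: contraNneq vb => /eqP; rewrite subr_eq0 => /eqP ->.
    by rewrite (dotZr ip) va mulr0.
  by rewrite !(dotE ip) aa bb (dotC ip b) -/g; nra.
pose psi := acos (- g).
have gint : -1 < - g < 1 by apply/andP; split; nra.
have /andP[g1 g3] := gint.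
have ab : dot a b = - cos psi by rewrite acosK ?opprK// in_itv/= !ltW.
have psi_int : 0 < psi < pi by rewrite acos_gt0 ?acos_ltpi ?g1 ?g3 ?ltW.
have s0 : 0 < sin psi by rewrite sin_gt0_pi.
have [j [jm co mj]] := root_natpi sT tT sa tb ab psi_int.
set m := #[s * t]%g in jm co mj *; set th := pi / m%:R.
have m0 : 0 < m%:R :> R by rewrite ltr0n order_gt0.
have psij : psi = j%:R * th.
  by apply: (mulfI (lt0r_neq0 m0)); rewrite mj /th; field; rewrite gt_eqF.
have /andP[j0 jltm] := jm.
have [j1|j1] := eqVneq j 1%N; first by left; rewrite (dotC ip) ab psij j1 mul1r.
have j2 : (0 < j.-1 < m)%N.
  by case: (j) j0 j1 jltm => [|[|i]]//= _ _ /ltnW.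
right.
have sth : 0 < sin th :> R.
  by have := @sin_natpi_gt0 R m 1; rewrite mul1r; apply; rewrite (leq_ltn_trans _ jltm).
have psith : psi - th = j.-1%:R * th by rewrite psij -[in LHS](prednK j0) -natr1; ring.
have sj1 : 0 < sin (psi - th) by rewrite psith sin_natpi_gt0.
have sj : sin th <= sin psi by rewrite psij sin_natpi_ge.
(* [k] is minus the inverse of [j] modulo [m]: [k] steps of [psi] amount to [- th] modulo [pi],
   which gives [c] up to sign. *)
have [k _ kP] := Bezoutl j (order_gt0 (s * t)%g).
have /eqP gcd1 : coprime m j by rewrite coprime_sym.
rewrite -/m gcd1 in kP; have /dvdnP[q kq] := kP.
have kpsi : k%:R * psi = - th + q%:R * pi.
  have : (1 + k * j)%:R * th = (q * m)%:R * th by rewrite kq.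
  rewrite natrD !natrM psij => h; rewrite mulrA.
  have mth : m%:R * th = pi by rewrite /th; field; rewrite gt_eqF.
  by rewrite -mth; lra.
pose c := (sin psi)^-1 *: (sin th *: b - sin (psi - th) *: a).
have [z zT zr] := dihedral_root k sT tT sa tb ab (lt0r_neq0 s0).
have zc : root z c.
  have dk : dvec psi a b (k%:R * psi) =
      (-1) ^+ q *: - (sin th *: b - sin (psi - th) *: a).
    rewrite /dvec kpsi addrAC !sinDnpi sinN opprB scalerBr !scalerA addrC.
    by rewrite [X in sin X]addrC mulrN scaleNr addrC.
  move: zr; rewrite dk scalerA mulrC -scalerA scalerN -/c -signr_odd.
  by case: (odd q); rewrite ?expr1 ?expr0 ?scale1r// ?scaleN1r ?opprK// => /rootN; rewrite opprK.
have ca : dot c a = - cos th.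
  rewrite /c !(dotE ip) aa (dotC ip b) ab; apply: (mulfI (lt0r_neq0 s0)).
  rewrite mulrA divff ?lt0r_neq0// sinB; ring.
have bE : b = (sin psi / sin th) *: c + (sin (psi - th) / sin th) *: a.
  apply: (scalerI (lt0r_neq0 sth)); rewrite scalerDr !scalerA.
  rewrite ![sin th * (_ / _)]mulrCA divff ?lt0r_neq0// !mulr1.
  by rewrite divff ?lt0r_neq0// scale1r subrK.
have [zT' zG] : z \in T /\ z \in <<[set s; t]>>%g by apply/andP; rewrite -in_setI.
exists z, c, (sin psi / sin th), (sin (psi - th) / sin th); split=> //; last first.
  by split=> //; rewrite ler_pdivlMr// mul1r sj divr_gt0.
(* Starting from [c] and [a] at step [th], the root of index [j.-1] is [b]; hence [t] lies in the
   group generated by [s] and [z]. *)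
have [u uT ur] := dihedral_root j.-1 zT' sT zc sa ca (lt0r_neq0 sth).
have ub : root u b.
  rewrite bE; move: ur; rewrite /dvec scalerDr !scalerA -psith subrK.
  by rewrite ![_^-1 * _]mulrC.
have [uT' uG] : u \in T /\ u \in <<[set z; s]>>%g by apply/andP; rewrite -in_setI.
by rewrite -(root_inj (subsetP TW _ uT') (subsetP TW _ tT) ub tb) setUC.
Qed.

End Reflections.

(** * Adjoining a root to a system of simple roots *)

(** The vector [p] is normal to the boundary of an open half-space containing the roots; [dot p] is
    the positive linear form of Tits' argument. *)
Record simple_roots (gT : finGroupType) (T : {set gT}) (R : realType)
    (V : lmodType R) (dot : V -> V -> R) (act : V -> gT -> V)
    (D : {set gT}) (a : gT -> V) (p : V) : Prop := SimpleRoots {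
  simple_sub : D \subset T;
  simple_root : forall s, s \in D -> root dot act s (a s);
  simple_pos : forall s, s \in D -> 0 < dot p (a s);
  simple_dot : {in D &, forall s t, s != t ->
    dot (a s) (a t) = - cos (pi / #[s * t]%g%:R)}
}.

Section Extension.
Variables (gT : finGroupType) (W : {group gT}) (R : realType) (V : lmodType R).
Variables (dot : V -> V -> R) (act : V -> gT -> V) (T : {set gT}).
Hypotheses (ip : inner_product dot) (rep : reflection_rep W dot act).
Hypotheses (TW : T \subset W) (TJ : {in T & W, forall t w, (t ^ w)%g \in T}).
Hypothesis T_root : forall t, t \in T -> exists a, root dot act t a.
Local Notation root := (root dot act).
Local Notation simple_roots := (simple_roots T dot act).

Lemma simple_roots0 : simple_roots set0 (fun _ => 0) 0.
Proof. by split=> [|s|s|s t]; rewrite ?sub0set ?inE. Qed.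

(* Among the reflections [t'] with <D, t'> = <D, t>, the one whose root [b]
   minimises first [dot v b] and then [dot p b] makes the right angle with each
   root of [D]: otherwise [dihedral_step] would replace it by a smaller one. *)
Lemma simple_roots_extend D a p t b v : simple_roots D a p ->
  t \in T -> root t b -> (forall s, s \in D -> act v s = v) -> dot v b != 0 ->
  exists t' a' p', <<t' |: D>>%g = <<t |: D>>%g /\ simple_roots (t' |: D) a' p'.
Proof.
move=> [DT Droot Dpos Ddot] tT tb vD vb.
have va s : s \in D -> dot v (a s) = 0.
  by move=> sD; apply/(root_fix ip _ (Droot _ sD))/vD.
have /choice[rt rtP] : forall u, exists c, u \in T -> root u c.
  move=> u; case uT : (u \in T); last by exists 0.
  by have [c uc] := T_root uT; exists c.
pose C u := (u \in T) && (<<u |: D>>%g == <<t |: D>>%g).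
have Ct : C t by rewrite /C tT eqxx.
have DuT u : u \in T -> u |: D \subset W.
  by move=> uT; rewrite (subset_trans _ TW)// subUset sub1set uT.
(* If the root of [u] were orthogonal to [v], the group generated by [u] and [D], which contains
   [t], would fix [v]. *)
have Cv u : C u -> dot v (rt u) != 0.
  case/andP=> uT /eqP uD; apply/negP => /eqP /(root_fix ip v (rtP u uT)) uv.
  have : act v t = v.
    apply: (fix_gen rep (DuT u uT)); last by rewrite uD mem_gen// setU11.
    by move=> w /setU1P[->//|/vD].
  by move/(root_fix ip v tb)/eqP; apply/negP.
pose r u := if 0 < dot v (rt u) then rt u else - rt u.
have rP u : C u -> root u (r u) /\ 0 < dot v (r u).
  move=> Cu; have := Cv _ Cu; have /andP[uT _] := Cu; rewrite /r.
  case: ltP => [? _|h n]; split=> //; [exact: rtP|exact/(rootN ip)/rtP|].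
  by rewrite (dotNr ip) oppr_gt0 lt_neqAle n h.
have r_uniq u c : C u -> root u c -> 0 < dot v c -> c = r u.
  move=> Cu uc vc; have [ur vr] := rP u Cu.
  have [//|cN] := root_pm ip uc ur.
  by move: vc; rewrite cN (dotNr ip) oppr_gt0 ltNge ltW.
have [t1 Ct1 t1min] := @Order.TotalTheory.arg_minP _ R _ t C (fun u => dot v (r u)) Ct.
pose C' u := C u && (dot v (r u) == dot v (r t1)).
have C't1 : C' t1 by rewrite /C' Ct1 eqxx.
have [t2 /andP[Ct2 /eqP v2] t2min] :=
  @Order.TotalTheory.arg_minP _ R _ t1 C' (fun u => dot p (r u)) C't1.
have [r2 vr2] := rP _ Ct2; have /andP[t2T /eqP t2D] := Ct2.
have t2nD : t2 \notin D.
  by apply: contraTN vr2 => /vD /(root_fix ip v r2) ->; rewrite ltxx.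
have t2dot s : s \in D -> dot (r t2) (a s) = - cos (pi / #[s * t2]%g%:R).
  move=> sD; have sT := subsetP DT _ sD.
  have [//|[t' [c [x [y [t'T t'c t'G t2G [rE [x1 y0]]]]]]]] :=
    dihedral_step ip rep TW TJ sT t2T (Droot _ sD) r2 (va s sD) (lt0r_neq0 vr2).
  have vrE : dot v (r t2) = x * dot v c by rewrite rE !(dotE ip) va// mulr0 addr0.
  have vc : 0 < dot v c by rewrite vrE in vr2; rewrite -(pmulr_rgt0 _ (lt_le_trans ltr01 x1)).
  have Ct' : C t'.
    have gen_le u w : u \in <<[set s; w]>>%g -> <<u |: D>>%g \subset <<w |: D>>%g.
      move=> uG; rewrite gen_subG subUset sub1set sub_gen ?subsetUr// andbT.
      apply: subsetP uG; rewrite genS// subUset !sub1set !inE sD eqxx orbT//.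
    by rewrite /C t'T -t2D eqEsubset !gen_le.
  have cE := r_uniq _ _ Ct' t'c vc.
  (* The first minimality forces [x = 1]. Then the old root is [c + y *: a s], which has the larger
     product with [p], against the second minimality. *)
  have := t1min _ Ct'; rewrite -v2 vrE -cE => le.
  have x_eq1 : x = 1.
    by apply/le_anti; rewrite x1 andbT -(ler_pM2r vc) mul1r.
  have : C' t' by rewrite /C' Ct' -v2 vrE -cE x_eq1 mul1r eqxx.
  move/t2min; rewrite -cE rE x_eq1 scale1r !(dotE ip).
  by rewrite gerDl leNgt mulr_gt0// Dpos.
pose a' s := if s == t2 then r t2 else a s.
have a'D s : s \in D -> a' s = a s.
  by rewrite /a'; case: eqP => // -> /(negP t2nD).
have a't2 : a' t2 = r t2 by rewrite /a' eqxx.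
(* [M] is large enough that [M *: v + p] is positive on the new root; adding a multiple of [v]
   changes nothing on the roots of [D]. *)
pose M := (1 + `|dot p (r t2)|) / dot v (r t2).
exists t2, a', (M *: v + p); split=> //.
split=> [|s /setU1P[->|sD]|s /setU1P[->|sD]|s u /setU1P[->|sD] /setU1P[->|uD] su].
- by rewrite subUset sub1set t2T.
- by rewrite a't2.
- by rewrite a'D//; apply: Droot.
- rewrite a't2 !(dotE ip) divfK ?lt0r_neq0//.
  move: (dot p (r t2)) => d; rewrite -addrA ltr_pwDl// -(opprK d) normrN subr_ge0.
  exact: ler_norm.
- by rewrite a'D// !(dotE ip) va// mulr0 add0r Dpos.
- by rewrite eqxx in su.
- rewrite a't2 a'D// t2dot// -[in RHS](orderJ _ t2) conjgE !mulgA.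
  by rewrite mulVg mul1g.
- by rewrite a't2 a'D// (dotC ip) t2dot.
- by rewrite !a'D// Ddot.
Qed.

End Extension.

(** * Words in generators and their products *)

Section WordProducts.
Variables (I : eqType) (G : groupType) (g : I -> G) (m : I -> I -> nat).

Definition wprod (w : seq I) : G := (\prod_(i <- w) g i)%g.

Lemma wprod_cat u w : wprod (u ++ w) = (wprod u * wprod w)%g.
Proof. exact: big_cat. Qed.

Lemma wprod_alt k i j : wprod (alt k.*2 i j) = ((g i * g j) ^+ k)%g.
Proof.
elim: k => [|k IHk]; first by rewrite /wprod big_nil expg0.
by rewrite doubleS /= /wprod !big_cons -/(wprod _) IHk expgS mulgA.
Qed.

Lemma coxeter_congruence_wprod : (forall i, g i * g i = 1)%g ->
  (forall i j, i != j -> (g i * g j) ^+ m i j = 1)%g ->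
  coxeter_congruence m (fun w w' => wprod w = wprod w').
Proof.
move=> g2 gm; have w1 : wprod [::] = 1%g by rewrite /wprod big_nil.
split=> [//|//|w w' w'' -> //|u u' w w' uu' ww'|i|i j ij].
- by rewrite !wprod_cat uu' ww'.
- by rewrite w1 /wprod !big_cons big_nil mulg1 g2.
- by rewrite w1 wprod_alt gm.
Qed.

End WordProducts.

Lemma coxeter_congruenceI (I : eqType) (m : I -> I -> nat)
    (E F : seq I -> seq I -> Prop) :
  coxeter_congruence m E -> coxeter_congruence m F ->
  coxeter_congruence m (fun w w' => E w w' /\ F w w').
Proof.
move=> cE cF; split.
- by move=> w; split; [exact: (cox_refl cE) | exact: (cox_refl cF)].
- by move=> w w' []; split; [exact: (cox_sym cE) | exact: (cox_sym cF)].
- move=> w w' w'' [e f] [e' f'].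
  by split; [exact: (cox_trans cE e e') | exact: (cox_trans cF f f')].
- move=> u u' w w' [e f] [e' f'].
  by split; [exact: (cox_cat cE) | exact: (cox_cat cF)].
- by move=> i; split; [exact: (cox_inv cE) | exact: (cox_inv cF)].
- by move=> i j ij; split; [exact: (cox_braid cE) | exact: (cox_braid cF)].
Qed.

(** No inverse letters occur: a subset of a finite group that contains 1 and is closed under
    products is a subgroup. *)
Lemma gen_wprod (gT : finGroupType) (D : {set gT}) x : x \in <<D>>%g ->
  exists w : seq {s : gT | s \in D}, wprod val w = x.
Proof.
pose F := [set y | `[< exists w : seq {s : gT | s \in D}, wprod val w = y >]].
have Fgrp : group_set F.
  apply/group_setP; split.
    by rewrite inE; apply/asboolP; exists [::]; rewrite /wprod big_nil.
  move=> y z; rewrite !inE => /asboolP[w <-] /asboolP[u <-]; apply/asboolP.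
  by exists (w ++ u); rewrite wprod_cat.
have DF : D \subset Group Fgrp.
  apply/subsetP => s sD; rewrite inE; apply/asboolP; exists [:: exist _ s sD].
  by rewrite /wprod big_seq1.
by rewrite -gen_subG in DF => /(subsetP DF); rewrite inE => /asboolP.
Qed.

(** * The Coxeter property of simple roots *)

Section SimpleRootsCoxeter.
Variables (gT : finGroupType) (W : {group gT}) (R : realType) (V : lmodType R).
Variables (dot : V -> V -> R) (act : V -> gT -> V) (T : {set gT}).
Hypotheses (ip : inner_product dot) (rep : reflection_rep W dot act).
Hypothesis TW : T \subset W.

Lemma root_sq s a : s \in W -> root dot act s a -> (s * s = 1)%g.
Proof.
move=> sW [aa sa]; apply: (rep_faithful rep) => [|x]; first by rewrite groupM.
by rewrite (repM rep)// !sa (hreflK ip aa).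
Qed.

Lemma root_order s a : s \in W -> root dot act s a -> #[s]%g = 2.
Proof.
move=> sW sa; apply: nt_prime_order => //; first by rewrite expgS expg1 (root_sq sW sa).
apply/eqP => s1; case: sa => aa /(_ a).
rewrite s1 (rep1 rep) hrefl_self// => /eqP; rewrite -subr_eq0 opprK -mulr2n.
by rewrite -scaler_nat scaler_eq0 pnatr_eq0/= => /eqP /eqP; apply/negP/(unit_neq0 ip).
Qed.

(** Tits' argument is applied to equality of products in [W] and in [H] together. Words with equal
    products in [W] then have equal products in [H], so the extension of [f] can be read off any
    word. *)
Theorem simple_roots_coxeter D a p : simple_roots T dot act D a p ->
  coxeter_system <<D>>%g D.
Proof.
move=> [DT Droot Dpos Ddot].
have DW s : s \in D -> s \in W by move/(subsetP DT)/(subsetP TW).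
split=> // [s sD|H f frel]; first exact: root_order (DW s sD) (Droot s sD).
pose I : eqType := {s : gT | s \in D}.
pose g (i : I) : gT := val i; pose h (i : I) : H := f (g i).
pose m (i j : I) := #[g i * g j]%g.
have gD i : g i \in D by apply: valP.
have D2 s : s \in D -> (s * s = 1)%g by move=> sD; apply: root_sq (DW s sD) (Droot s sD).
pose E w w' := wprod g w = wprod g w' /\ wprod h w = wprod h w'.
have coxE : coxeter_congruence m E.
  apply: coxeter_congruenceI; apply: coxeter_congruence_wprod => [i|i j ij].
  - exact: D2.
  - exact: expg_order.
  - by have := frel _ _ (gD i) (gD i); rewrite D2// order1 expg1.
  - exact: frel.
have gW w : wprod g w \in W.
  by rewrite /wprod; elim/big_rec: _ => // i u _; apply/groupM/DW.
have wactE x (w : seq I) : wact dot (a \o g) x w = act x (wprod g w).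
  elim: w x => [|i w IHw] x; first by rewrite /wprod big_nil (rep1 rep).
  rewrite /wprod big_cons /= -/(wprod g w) IHw -(Droot (g i) (gD i)).2 (repM rep)//.
  exact: DW.
have a_unit i : dot ((a \o g) i) ((a \o g) i) = 1 by case: (Droot _ (gD i)).
have m_gt1 i j : i != j -> (1 < m i j)%N.
  move=> ij; rewrite order_gt1; apply: contraNneq ij => /(canRL (mulgK _)).
  rewrite mul1g => gi; apply/eqP/val_inj; rewrite -/(g i) -/(g j) gi.
  by apply: (mulgI (g j)); rewrite mulgV D2.
have a_dot i j : i != j -> dot ((a \o g) i) ((a \o g) j) = - cos (pi / (m i j)%:R).
  by move=> ij; apply: Ddot.
have Ereal w w' : wprod g w = wprod g w' -> wprod h w = wprod h w'.
  move=> ww'.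
  have [_ w1] : E (w ++ rev w') [::].
    apply: (@tits _ _ _ ip _ (a \o g) m (dot p)) => //.
    - by move=> *; rewrite !(dotE ip).
    - by move=> i; apply: Dpos.
    - by move=> u u' [e _] x; rewrite !wactE e.
    move=> x; have [e _] := cox_rev coxE w'.
    by rewrite wactE wprod_cat ww' -wprod_cat e /wprod big_nil (rep1 rep).
  have [_ w'1] := cox_rev coxE w'.
  move: w1; rewrite -w'1 !wprod_cat; exact: mulIg.
have /choice[wd wdP] : forall x, exists w, x \in <<D>>%g -> wprod g w = x.
  move=> x; case xD : (x \in <<D>>%g); last by exists [::].
  by have [w wx] := gen_wprod xD; exists w.
exists (fun x => wprod h (wd x)) => [x y xD yD | s sD] /=.
  by rewrite -wprod_cat; apply: Ereal; rewrite wprod_cat !wdP// groupM.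
rewrite (Ereal _ [:: exist _ s sD]) /wprod big_seq1//.
by rewrite -/(wprod g _) wdP// mem_gen.
Qed.

End SimpleRootsCoxeter.

(** * The geometric representation of a Coxeter system *)

(** The group in which the universal property of the presentation is used to build the geometric
    representation. *)
Definition GLmx (R : realType) (n : nat) := {A : 'M[R]_n | A \in unitmx}.

Section GLmx.
Variables (R : realType) (n : nat).

HB.instance Definition _ := Choice.on (GLmx R n).

Definition GLmx_one : GLmx R n := exist _ 1%:M (unitmx1 R n).

(** The default of [insubd] is never taken, since a product of invertible matrices is invertible. *)
Definition GLmx_mul (A B : GLmx R n) : GLmx R n :=
  insubd GLmx_one (val A *m val B).

Definition GLmx_inv (A : GLmx R n) : GLmx R n := insubd GLmx_one (invmx (val A)).

Lemma GLmx_unit (A : GLmx R n) : val A \in unitmx.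
Proof. exact: (valP A). Qed.

Lemma val_GLmx_mul A B : val (GLmx_mul A B) = val A *m val B.
Proof. by rewrite val_insubd unitmx_mul !GLmx_unit. Qed.

Lemma val_GLmx_inv A : val (GLmx_inv A) = invmx (val A).
Proof. by rewrite val_insubd unitmx_inv GLmx_unit. Qed.

Fact GLmx_mulA : associative GLmx_mul.
Proof. by move=> A B C; apply: val_inj; rewrite !val_GLmx_mul mulmxA. Qed.

Fact GLmx_mul1 : left_id GLmx_one GLmx_mul.
Proof. by move=> A; apply: val_inj; rewrite val_GLmx_mul mul1mx. Qed.

Fact GLmx_mulr1 : right_id GLmx_one GLmx_mul.
Proof. by move=> A; apply: val_inj; rewrite val_GLmx_mul mulmx1. Qed.

Fact GLmx_mulV : left_inverse GLmx_one GLmx_inv GLmx_mul.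
Proof.
by move=> A; apply: val_inj; rewrite val_GLmx_mul val_GLmx_inv mulVmx ?GLmx_unit.
Qed.

Fact GLmx_mulrV : right_inverse GLmx_one GLmx_inv GLmx_mul.
Proof.
by move=> A; apply: val_inj; rewrite val_GLmx_mul val_GLmx_inv mulmxV ?GLmx_unit.
Qed.

HB.instance Definition _ := isGroup.Build (GLmx R n)
  GLmx_mulA GLmx_mul1 GLmx_mulr1 GLmx_mulV GLmx_mulrV.

Lemma val_GLmxM (A B : GLmx R n) : val (A * B)%g = val A *m val B.
Proof. exact: val_GLmx_mul. Qed.

Lemma val_GLmx1 : val (1%g : GLmx R n) = 1%:M.
Proof. by []. Qed.

Lemma GLmx_eq1 (A : GLmx R n) : (forall x : 'rV_n, x *m val A = x) -> A = 1%g.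
Proof.
move=> A1; apply/val_inj/row_matrixP => i.
by rewrite !rowE A1 val_GLmx1 mulmx1.
Qed.

End GLmx.

Section GeometricRepresentation.
Variables (R : realType) (gT : finGroupType) (W : {group gT}) (S : {set gT}).
Hypothesis WS : coxeter_system W S.
Local Notation n := #|S|.
Local Notation V := 'rV[R]_n.
Implicit Types (x y : V) (s t : gT).

(* On the diagonal, [#[s * s] = 1] and [- cos pi = 1]. *)
Definition cox_mx : 'M[R]_n :=
  \matrix_(j, k) - cos (pi / #[enum_val j * enum_val k]%g%:R).

Definition cox_form x y : R := (x *m cox_mx *m y^T) 0 0.

Definition cox_vec s : V := \row_j (enum_val j == s)%:R.

Definition cox_refl_mx s : 'M[R]_n :=
  1%:M - 2 *: (cox_mx *m (cox_vec s)^T *m cox_vec s).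

Lemma cox_mx_sym : cox_mx^T = cox_mx.
Proof.
apply/matrixP => j k; rewrite !mxE; set u := enum_val _; set w := enum_val _.
by rewrite -(orderJ (u * w)%g u) conjgE !mulgA mulVg mul1g.
Qed.

Lemma cox_form_bilinear : sym_bilinear cox_form.
Proof.
split=> [x y|c x y z]; rewrite /cox_form.
  have -> : x *m cox_mx *m y^T = (y *m cox_mx *m x^T)^T.
    by rewrite !trmx_mul trmxK cox_mx_sym mulmxA.
  by rewrite mxE.
by rewrite !mulmxDl -!scalemxAl !mxE.
Qed.

Lemma cox_vec_enum j : cox_vec (enum_val j) = delta_mx 0 j.
Proof. by apply/rowP => k; rewrite !mxE (inj_eq enum_val_inj). Qed.

Lemma cox_form_vec s t : s \in S -> t \in S ->
  cox_form (cox_vec s) (cox_vec t) = - cos (pi / #[s * t]%g%:R).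
Proof.
move=> sS tS; rewrite -(enum_rankK_in sS sS) -(enum_rankK_in tS tS) !cox_vec_enum.
by rewrite /cox_form -rowE trmx_delta -colE !mxE.
Qed.

Lemma mul_cox_refl_mx s x : x *m cox_refl_mx s = hrefl cox_form (cox_vec s) x.
Proof.
rewrite /cox_refl_mx mulmxBr mulmx1 /hrefl -scalemxAr !mulmxA.
by rewrite [X in X *m cox_vec s]mx11_scalar mul_scalar_mx scalerA.
Qed.

Let S_sq s : s \in S -> (s * s = 1)%g.
Proof. by case: WS => _ o2 _ sS; rewrite -[RHS](expg_order s) o2. Qed.

Let cox_unit s : s \in S -> cox_form (cox_vec s) (cox_vec s) = 1.
Proof. by move=> sS; rewrite cox_form_vec// S_sq// order1 divr1 cospi opprK. Qed.

Let cox_order_gt1 s t : s \in S -> t \in S -> s != t -> (1 < #[s * t]%g)%N.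
Proof.
move=> sS tS st; rewrite order_gt1; apply: contraNneq st => /(canRL (mulgK _)).
by rewrite mul1g => ->; apply/eqP/(mulgI t); rewrite mulgV S_sq.
Qed.

Definition cox_gl s : GLmx R n := insubd (GLmx_one R n) (cox_refl_mx s).

Let mul_cox_gl s x : s \in S -> x *m val (cox_gl s) = hrefl cox_form (cox_vec s) x.
Proof.
move=> sS; rewrite val_insubd.
have -> : cox_refl_mx s \in unitmx; last exact: mul_cox_refl_mx.
apply: (@proj1 _ _ (@mulmx1_unit _ _ _ (cox_refl_mx s) _)).
apply/row_matrixP => i; rewrite row1 rowE mulmxA !mul_cox_refl_mx.
by rewrite (hreflK cox_form_bilinear (cox_unit sS)).
Qed.

Let cox_gl_rel s t : s \in S -> t \in S ->
  ((cox_gl s * cox_gl t) ^+ #[s * t]%g = 1)%g.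
Proof.
move=> sS tS; apply: GLmx_eq1 => x.
have glX k : x *m val ((cox_gl s * cox_gl t) ^+ k)%g =
    iter k (fun x => hrefl cox_form (cox_vec t) (hrefl cox_form (cox_vec s) x)) x.
  elim: k => [|k IHk]; first by rewrite expg0 val_GLmx1 mulmx1.
  by rewrite expgSr val_GLmxM mulmxA IHk val_GLmxM mulmxA !mul_cox_gl.
rewrite glX; have [->|st] := eqVneq s t.
  by rewrite S_sq// order1 /= (hreflK cox_form_bilinear (cox_unit tS)).
have st1 := cox_order_gt1 sS tS st.
have ts : cox_form (cox_vec t) (cox_vec s) = - cos (pi / #[s * t]%g%:R).
  by rewrite (dotC cox_form_bilinear) cox_form_vec.
(* The angle is [pi / m] with [m] the order of [s * t], so [m] steps amount to [1 * pi]. *)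
apply: (iter_hrefl_id cox_form_bilinear x (j := 1) (cox_unit tS) (cox_unit sS) ts).
  by have := @sin_natpi_gt0 R #[s * t]%g 1; rewrite mul1r => h; apply/lt0r_neq0/h.
by rewrite mul1r mulrCA divff ?mulr1// pnatr_eq0 -lt0n order_gt0.
Qed.

(** Faithfulness is Tits' argument for [cox_form]. The inner product is the standard one summed over
    [W], hence invariant. A fixed vector is orthogonal to every root, and the roots of [S] are
    multiples of the basis vectors. *)
Theorem geometric_representation :
  exists (dot : V -> V -> R) (act : V -> gT -> V),
    [/\ inner_product dot, reflection_rep W dot act &
        forall s, s \in S -> exists a, root dot act s a].
Proof.
have [defW _ univ] := WS; have bil := cox_form_bilinear.
have [phi phiM phiS] := univ _ cox_gl (fun s t => @cox_gl_rel s t).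
have SW s : s \in S -> s \in W by move=> sS; rewrite -defW mem_gen.
pose act x w : V := x *m val (phi w).
have actP w c x y : act (c *: x + y) w = c *: act x w + act y w.
  by rewrite /act mulmxDl -scalemxAl.
have actM : {in W &, forall w u x, act x (w * u)%g = act (act x w) u}.
  by move=> w u wW uW x; rewrite /act phiM// val_GLmxM mulmxA.
have act1 x : act x 1%g = x.
  have : phi 1%g = 1%g by apply: (mulgI (phi 1%g)); rewrite -phiM// !mulg1.
  by rewrite /act => ->; rewrite val_GLmx1 mulmx1.
have actS s x : s \in S -> act x s = hrefl cox_form (cox_vec s) x.
  by move=> sS; rewrite /act phiS// mul_cox_gl.
pose I : eqType := {s : gT | s \in S}; pose g (i : I) : gT := val i.
have gS i : g i \in S by apply: valP.
pose m (i j : I) := #[g i * g j]%g.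
have gW w : wprod g w \in W.
  by rewrite /wprod; elim/big_rec: _ => // i u _; apply/groupM/SW.
have wactE x (w : seq I) : wact cox_form (cox_vec \o g) x w = act x (wprod g w).
  elim: w x => [|i w IHw] x; first by rewrite /wprod big_nil act1.
  by rewrite /wprod big_cons /= -/(wprod g w) IHw -actS// actM// SW.
have faithful w : w \in W -> (forall x, act x w = x) -> w = 1%g.
  move=> wW w1; have [u uw] : exists u : seq I, wprod g u = w.
    by apply: gen_wprod; rewrite defW.
  rewrite -uw (_ : 1%g = wprod g [::]); last by rewrite /wprod big_nil.
  (* The simple roots are the basis vectors, so the sum of coordinates is positive on them. *)
  pose lam x := \sum_j x 0 j.
  apply: (@tits _ _ _ bil _ (cox_vec \o g) m lam _ _ _ _ _ (fun w w' => wprod g w = wprod g w')).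
  - by move=> i; apply: cox_unit.
  - by move=> i j ij; apply: cox_order_gt1.
  - by move=> i j ij; apply: cox_form_vec.
  - by move=> c x y; rewrite /lam mulr_sumr -big_split; apply: eq_bigr => j _; rewrite !mxE.
  - move=> i; rewrite /lam /= -(enum_rankK_in (gS i) (gS i)) cox_vec_enum.
    rewrite (bigD1 (enum_rank_in (gS i) (g i)))//= big1 ?addr0 ?mxE ?eqxx//.
    by move=> j ji; rewrite mxE (negPf ji) andbF.
  - apply: coxeter_congruence_wprod => [i|i j _]; [exact: S_sq|exact: expg_order].
  - by move=> u1 u2 e x; rewrite !wactE e.
  - by move=> x; rewrite wactE uw w1.
pose dot x y : R := \sum_(w in W) (act x w *m (act y w)^T) 0 0.
have dot_bil : sym_bilinear dot.
  split=> [x y|c x y z]; rewrite /dot.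
    apply: eq_bigr => w _; have -> : act x w *m (act y w)^T = (act y w *m (act x w)^T)^T.
      by rewrite [RHS]trmx_mul trmxK.
    by rewrite mxE.
  rewrite mulr_sumr -big_split; apply: eq_bigr => w _.
  by rewrite actP mulmxDl -scalemxAl !mxE.
have sq_ge0 x : 0 <= (x *m x^T) 0 0.
  by rewrite mxE sumr_ge0// => j _; rewrite mxE -expr2 sqr_ge0.
have dot_pos : inner_product dot.
  split=> // x x0; rewrite /dot (bigD1 1%g)//= act1 ltr_pwDl ?sumr_ge0//.
  have [j xj] : exists j, x 0 j != 0.
    apply/existsP; apply: contraNT x0; rewrite negb_exists => /forallP x0.
    by apply/eqP/rowP => j; rewrite mxE; apply/eqP; have := x0 j; rewrite negbK.
  rewrite mxE (bigD1 j)//= mxE -expr2 ltr_pwDl ?exprn_even_gt0// sumr_ge0// => i _.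
  by rewrite mxE -expr2 sqr_ge0.
have dot_act w : w \in W -> forall x y, dot (act x w) (act y w) = dot x y.
  move=> wW x y; rewrite /dot [RHS](reindex_inj (mulgI w)); apply: eq_big => u.
    by rewrite groupMl.
  by move=> uW; rewrite !actM// groupM.
have vec_pos s : s \in S -> 0 < dot (cox_vec s) (cox_vec s).
  move=> sS; apply: (dot_gt0 dot_pos); exact: (unit_neq0 bil (cox_unit sS)).
pose a s := (Num.sqrt (dot (cox_vec s) (cox_vec s)))^-1 *: cox_vec s.
have a_root s : s \in S -> root dot act s (a s).
  move=> sS; have p0 := vec_pos s sS; set p := dot _ _ in p0.
  have sp : Num.sqrt p ^+ 2 = p by rewrite sqr_sqrtr// ltW.
  have sp0 : Num.sqrt p != 0 by rewrite sqrtr_eq0 -ltNge.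
  split=> [|x]; first by rewrite /a !(dotE dot_bil) -/p -{3}sp; field.
  rewrite actS// /hrefl /a (dotZr dot_bil) scalerA; congr (_ - _ *: _).
  (* Since [s] negates [cox_vec s], invariance makes [cox_form] and [dot] proportional against this
     vector; so [s] is also a reflection for [dot]. *)
  have := dot_act s (SW s sS) x (cox_vec s).
  rewrite !actS// (hrefl_self (cox_unit sS)) /hrefl !(dotE dot_bil) -/p => e.
  have -> : dot x (cox_vec s) = cox_form x (cox_vec s) * p by lra.
  by rewrite -{2}sp -/p; field.
exists dot, act; split=> //; last by move=> s sS; exists (a s); apply: a_root.
split=> // x xW; apply/eqP/negPn/negP => /(dot_gt0 dot_pos).
suff -> : dot x x = 0 by rewrite ltxx.
rewrite [X in dot _ X]row_sum_delta; elim/big_ind: _ => [|y z xy xz|j _].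
- by rewrite (dotC dot_bil) (dot0l dot_bil).
- by rewrite (dotDr dot_bil) xy xz addr0.
have sS := enum_valP j; have [aa sa] := a_root _ sS.
have : dot x (a (enum_val j)) = 0.
  by apply/(hrefl_id dot_bil x aa); rewrite -sa xW// SW.
rewrite /a !(dotZr dot_bil) cox_vec_enum => /eqP; rewrite mulf_eq0 invr_eq0 sqrtr_eq0.
by rewrite leNgt -cox_vec_enum vec_pos//= => /eqP ->; rewrite mulr0.
Qed.

End GeometricRepresentation.

(** * Reflections and rank *)

(** The conditions are [#|A|] linear equations in [n] unknowns; a solution is a row of the left
    kernel of [M]. *)
Lemma exists_orthogonal (R : realType) (n : nat) (dot : 'rV[R]_n -> 'rV[R]_n -> R)
    (I : finType) (A : {set I}) (c : I -> 'rV[R]_n) :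
  sym_bilinear dot -> (#|A| < n)%N ->
  exists2 v, v != 0 & forall i, i \in A -> dot v (c i) = 0.
Proof.
move=> bil An; pose M := \matrix_(j < n, i < #|A|) dot (delta_mx 0 j) (c (enum_val i)).
exists (nz_row (kermx M)) => [|i iA].
  rewrite nz_row_eq0 -mxrank_eq0 mxrank_ker subn_eq0 -ltnNge.
  exact: leq_ltn_trans (rank_leq_col M) An.
have := nz_row_sub (kermx M); set v := nz_row _ => /sub_kermxP vM.
have <- : (v *m M) 0 (enum_rank_in iA i) = dot v (c i); last by rewrite vM mxE.
rewrite [in RHS](row_sum_delta v) mxE; set w := c i.
have dot_sum : dot^~ w (\sum_j v 0 j *: delta_mx 0 j) =
    \sum_j v 0 j * dot (delta_mx 0 j) w.
  elim/big_rec2: _ => [|j x y _ <-]; first exact: dot0l bil _.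
  by rewrite (dotDl bil) (dotZl bil).
by rewrite dot_sum; apply: eq_bigr => j _; rewrite mxE enum_rankK_in.
Qed.

Definition reflections (gT : finGroupType) (W S : {set gT}) : {set gT} :=
  [set (w * s * w^-1)%g | w in W, s in S].

Lemma reflectionsP (gT : finGroupType) (W : {group gT}) (S : {set gT}) t :
  reflect (exists w s, [/\ w \in W, s \in S & t = (s ^ w)%g]) (t \in reflections W S).
Proof.
apply: (iffP imset2P) => [[w s wW sS ->]|[w [s [wW sS ->]]]].
  by exists w^-1%g, s; rewrite groupV conjgE invgK mulgA.
by exists w^-1%g s; rewrite ?groupV// invgK conjgE mulgA.
Qed.

Section CoxeterReflections.
Variables (gT : finGroupType) (W : {group gT}) (S : {set gT}).
Hypothesis WS : coxeter_system W S.
Local Notation T := (reflections W S).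
Local Notation R := Rdefinitions.R.

Lemma simple_sub_group : S \subset W.
Proof. by case: WS => <- _ _; apply: subset_gen. Qed.

Lemma simple_sub_reflections : S \subset T.
Proof. by apply/subsetP => s sS; apply/reflectionsP; exists 1%g, s; rewrite conjg1. Qed.

Lemma reflections_sub : T \subset W.
Proof.
apply/subsetP => t /reflectionsP[w [s [wW sS ->]]].
by rewrite groupJ// (subsetP simple_sub_group).
Qed.

Lemma reflectionsJ : {in T & W, forall t w, (t ^ w)%g \in T}.
Proof.
move=> t u /reflectionsP[w [s [wW sS ->]]] uW; apply/reflectionsP.
by exists (w * u)%g, s; rewrite groupM// conjgM.
Qed.

Lemma reflections_representation :
  exists (dot : 'rV[R]_#|S| -> 'rV[R]_#|S| -> R) (act : 'rV[R]_#|S| -> gT -> 'rV[R]_#|S|),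
    [/\ inner_product dot, reflection_rep W dot act &
        forall t, t \in T -> exists a, root dot act t a].
Proof.
have [dot [act [ip rep S_root]]] := geometric_representation R WS.
exists dot, act; split=> // t /reflectionsP[w [s [wW sS ->]]].
have [a sa] := S_root s sS; exists (act a w).
exact: (root_conj rep (subsetP simple_sub_group _ sS) wW sa).
Qed.

(** Fewer reflections than the dimension have a common nonzero fixed vector, which [W] cannot
    have. *)
Lemma rank_le_generators (A : {set gT}) : A \subset T -> <<A>>%g = W -> (#|S| <= #|A|)%N.
Proof.
move=> AT AW; have [dot [act [ip rep T_root]]] := reflections_representation.
rewrite leqNgt; apply/negP => ltAS.
have /choice[rt rtP] : forall u, exists c, u \in A -> root dot act u c.
  move=> u; case uA : (u \in A); last by exists 0.
  by have [c uc] := T_root u (subsetP AT _ uA); exists c.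
have [v /negP v0 vA] := exists_orthogonal rt ip ltAS.
apply/v0/eqP/(rep_fix0 rep) => w; rewrite -AW; apply: (fix_gen rep).
  exact: subset_trans AT reflections_sub.
by move=> u uA; apply/(root_fix ip v (rtP u uA))/vA.
Qed.

(* A class [s ^: W] of reflections avoiding [S'] would give a sign character of
   [W] that is trivial on [S'] but not at [s]. *)
Lemma sub_reflections (S' : {set gT}) : S' \subset T -> <<S'>>%g = W ->
  S \subset reflections W S'.
Proof.
move=> S'T S'W; apply/subsetP => s sS; have [_ o2 univ] := WS.
have SW := subsetP simple_sub_group.
apply: contraT => sT'.
have sq u : u \in S -> (u * u)%g = 1%g by move=> uS; rewrite -[RHS](expg_order u) o2.
(* With [z = u * v] of odd order and [k] half its successor, conjugating [u] by [z ^+ k] gives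
   [u * z ^+ k.*2 = u * z = v]. *)
have odd_class u v : u \in S -> v \in S -> odd #[u * v]%g -> v \in (u ^: W)%g.
  move=> uS vS ouv; set z := (u * v)%g in ouv; set k := uphalf #[z]%g.
  have SV x : x \in S -> (x^-1 = x)%g by move=> xS; apply: (mulgI x); rewrite mulgV sq.
  have zu : (z ^ u = z^-1)%g by rewrite /z conjgE invMg !SV// !mulgA sq// mul1g.
  apply/imsetP; exists (z ^+ k)%g; first by rewrite groupX// groupM ?SW.
  have -> : (u ^ (z ^+ k) = u * (z ^+ k * z ^+ k))%g.
    rewrite conjgE !mulgA; congr mulg; apply: (mulgI (z ^+ k)%g).
    rewrite mulKVg mulgA; apply: (mulgI u^-1%g).
    by rewrite mulVg !mulgA -(mulgA _ _ u) -conjgE conjXg zu expgVn mulVg.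
  by rewrite -expgD addnn odd_uphalfK// expgS expg_order mulg1 /z mulgA sq// mul1g.
(* The permutations of [bool] serve as the group of signs. *)
pose sg : {perm bool} := tperm true false.
have sg2 : (sg * sg)%g = 1%g by apply: tperm2.
pose f x : {perm bool} := if x \in (s ^: W)%g then sg else 1%g.
have frel u v : u \in S -> v \in S -> ((f u * f v) ^+ #[u * v])%g = 1%g.
  move=> uS vS.
  have [|/negPf ev] := boolP (odd #[u * v]%g).
    move/(odd_class u v uS vS)/class_eqP => uv; rewrite /f.
    have -> : (v \in (s ^: W)%g) = (u \in (s ^: W)%g).
      by rewrite ![_ \in (s ^: W)%g]class_sym uv.
    by case: ifP; rewrite ?sg2 ?mul1g expg1n.
  rewrite -(odd_double_half #[_]%g) ev add0n -mul2n expgM.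
  rewrite (_ : ((f u * f v) ^+ 2)%g = 1%g) ?expg1n//.
  by rewrite expgS expg1 /f; do 2!case: ifP => _; rewrite ?mul1g ?mulg1 ?sg2 ?mulg1.
have [phi phiM phiS] := univ _ f frel.
have phi1 : phi 1%g = 1%g by apply: (mulgI (phi 1%g)); rewrite -phiM// !mulg1.
pose K := [set x in W | phi x == 1%g].
have Kgrp : group_set K.
  apply/group_setP; split; first by rewrite inE group1 phi1 eqxx.
  move=> x y; rewrite !inE => /andP[xW /eqP x1] /andP[yW /eqP y1].
  by rewrite groupM// phiM// x1 y1 mulg1 eqxx.
(* Each member of [S'] is conjugate to some [u] in [S]. This [u] is not conjugate to [s], as [s]
   would then be conjugate to a member of [S']; so [phi] is trivial there. *)
have S'K : S' \subset Group Kgrp.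
  apply/subsetP => s' s'S'; have /reflectionsP[w [u [wW uS s'E]]] := subsetP S'T _ s'S'.
  have uW := SW _ uS; rewrite inE s'E groupJ//=.
  have fu : phi u = 1%g.
    rewrite phiS// /f; case: ifP => // /imsetP[x xW uE]; case/negP: sT'.
    apply/reflectionsP; exists (w^-1 * x^-1)%g, s'; rewrite groupM ?groupV//.
    by split=> //; rewrite s'E uE -!conjgM !mulgA mulgK mulgV conjg1.
  rewrite conjgE !phiM ?groupM ?groupV// fu mul1g -phiM ?groupV// mulVg phi1//.
have WK : <<S'>>%g \subset Group Kgrp by rewrite gen_subG.
rewrite S'W in WK; have := subsetP WK s (SW s sS).
rewrite inE phiS// /f class_refl => /andP[_ /eqP/permP/(_ true)].
by rewrite perm1 tpermL.
Qed.

End CoxeterReflections.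

(** * Simple systems adapted to a generating set, and the two implications *)

Lemma gen_setU1 (gT : finGroupType) (s : gT) (D B : {set gT}) :
  <<D>>%g = <<B>>%g -> <<s |: D>>%g = <<s |: B>>%g.
Proof. by move=> DB; rewrite -!joingE -joing_idr DB joing_idr. Qed.

(* Some [v != 0] is orthogonal to the roots of [A :\ s] and not to the root of
   [s], since the members of [A] have no common fixed vector. *)
Lemma simple_roots_generators (R : realType) (gT : finGroupType) (W : {group gT})
    (T A : {set gT}) (n : nat) (dot : 'rV[R]_n -> 'rV[R]_n -> R)
    (act : 'rV[R]_n -> gT -> 'rV[R]_n) :
  inner_product dot -> reflection_rep W dot act ->
  T \subset W -> {in T & W, forall t w, (t ^ w)%g \in T} ->
  (forall t, t \in T -> exists a, root dot act t a) ->
  A \subset T -> <<A>>%g = W -> (#|A| <= n)%N ->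
  forall (s : gT) (B D : {set gT}) a p, s \in A -> B \subset A :\ s -> <<D>>%g = <<B>>%g ->
    simple_roots T dot act D a p ->
  exists t a' p', <<t |: D>>%g = <<s |: B>>%g /\
    simple_roots T dot act (t |: D) a' p'.
Proof.
move=> ip rep TW TJ T_root AT AW An s B D a p sA BA DB Da.
have /choice[rt rtP] : forall u, exists c, u \in A -> root dot act u c.
  move=> u; case uA : (u \in A); last by exists 0.
  by have [c uc] := T_root u (subsetP AT _ uA); exists c.
have [|v v0 vA] := @exists_orthogonal _ _ _ _ (A :\ s) rt ip.
  by rewrite (cardsD1 s A) sA in An.
have AsubW : A \subset W := subset_trans AT TW.
have fixA u : u \in A :\ s -> act v u = v.
  by move=> uA; apply/(root_fix ip v (rtP u (subsetP (subD1set A s) _ uA)))/vA.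
have vs : dot v (rt s) != 0.
  apply: contra_neq v0 => vs; apply: (rep_fix0 rep) => w; rewrite -AW.
  apply: (fix_gen rep AsubW) => u uA; have [->|us] := eqVneq u s.
    exact/(root_fix ip v (rtP s sA)).
  by apply: fixA; rewrite !inE us.
have fixD u : u \in D -> act v u = v.
  move=> uD; have : u \in <<A :\ s>>%g.
    by apply: (subsetP (genS BA)); rewrite -DB mem_gen.
  by apply: (fix_gen rep) => //; apply: subset_trans AsubW; apply: subD1set.
have [t [a' [p' [tD ta]]]] := simple_roots_extend ip rep TW TJ T_root Da
  (subsetP AT _ sA) (rtP s sA) fixD vs.
by exists t, a', p'; split=> //; rewrite tD; apply: gen_setU1.
Qed.

(** Induction on [#|B|], adjoining one root at a time. *)
Lemma exists_simple_roots (R : realType) (gT : finGroupType) (W : {group gT})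
    (T A : {set gT}) (n : nat) (dot : 'rV[R]_n -> 'rV[R]_n -> R)
    (act : 'rV[R]_n -> gT -> 'rV[R]_n) :
  inner_product dot -> reflection_rep W dot act ->
  T \subset W -> {in T & W, forall t w, (t ^ w)%g \in T} ->
  (forall t, t \in T -> exists a, root dot act t a) ->
  A \subset T -> <<A>>%g = W -> (#|A| <= n)%N ->
  forall B : {set gT}, B \subset A ->
  exists (D : {set gT}) a p, <<D>>%g = <<B>>%g /\ simple_roots T dot act D a p.
Proof.
move=> ip rep TW TJ T_root AT AW An B.
have [k] := ubnP #|B|; elim: k B => // k IHk B /ltnSE Bk BA.
have [->|[s sB]] := set_0Vmem B.
  by exists set0, (fun _ => 0), 0; split=> //; apply: simple_roots0.
have [||D [a [p [DB Da]]]] := IHk (B :\ s).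
- by rewrite (cardsD1 s B) sB in Bk.
- exact: subset_trans (subD1set B s) BA.
have [t [a' [p' [tD ta]]]] := simple_roots_generators ip rep TW TJ T_root AT AW An
  (subsetP BA _ sB) (setSD _ BA) DB Da.
by exists (t |: D), a', p'; split=> //; rewrite tD setD1K.
Qed.

(** Here [S'] serves only as a generating set of [W']: a new system [D] of simple roots is built for
    [W'] and then completed by one reflection. *)
Lemma parabolic_of_extension (gT : finGroupType) (W W' : {group gT})
    (S S' : {set gT}) (t : gT) :
  coxeter_system W S -> S' \subset reflections W S -> <<S'>>%g = W' ->
  t \in reflections W S -> (#|S'| < #|S|)%N -> <<t |: W'>>%g = W ->
  parabolic W (reflections W S) W'.
Proof.
move=> WS S'T S'W' tT ltS tW.
have [dot [act [ip rep T_root]]] := reflections_representation WS.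
set T := reflections W S in S'T tT T_root *.
have TW : T \subset W := reflections_sub WS.
pose A := t |: S'.
have AT : A \subset T by rewrite subUset sub1set tT.
have AW : <<A>>%g = W.
  by rewrite -tW; apply: gen_setU1; rewrite S'W' genGid.
(* Otherwise [S'] alone would generate [W] with too few reflections. *)
have tS' : t \notin S'.
  apply/negP => tS'; have := rank_le_generators WS AT AW.
  by rewrite /A (setUidPr _) ?sub1set// leqNgt ltS.
have An : (#|A| <= #|S|)%N by rewrite cardsU1 tS'.
have S'A : S' \subset A :\ t by rewrite /A setU1K.
have [D [a [p [DS' Da]]]] := exists_simple_roots ip rep TW (@reflectionsJ _ W S) T_root
  AT AW An (subset_trans S'A (subD1set A t)).
have [u [a' [p' [uD ua]]]] := simple_roots_generators ip rep TW (@reflectionsJ _ W S)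
  T_root AT AW An (setU11 t S') S'A DS' Da.
exists (u |: D), D; split; [split|exact: subsetUr|by rewrite DS' S'W'].
  exact: simple_sub ua.
by have := simple_roots_coxeter ip rep TW ua; rewrite uD AW.
Qed.

Lemma extension_of_parabolic (gT : finGroupType) (W W' : {group gT})
    (S S' : {set gT}) :
  (0 < #|S|)%N -> coxeter_system W S -> coxeter_system W' S' ->
  W' :&: reflections W S = reflections W' S' -> #|S'| = #|S|.-1 ->
  parabolic W (reflections W S) W' ->
  exists2 t, t \in reflections W S & <<t |: W'>>%g = W.
Proof.
move=> S0 WS W'S' TW' cS' [P [I [[PT WP] IP W'I]]].
have PW : <<P>>%g = W by case: WP.
have SW : <<S>>%g = W by case: WS.
(* The roles are exchanged: [P] is the Coxeter system, and [S] is a generating set of reflections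
   for it. *)
have cP : (#|P| <= #|S|)%N.
  exact: (rank_le_generators WP (sub_reflections WS PT PW) SW).
have cI : (#|S|.-1 <= #|I|)%N.
  rewrite -cS'; apply: (rank_le_generators W'S') => //.
  by rewrite -TW' subsetI W'I subset_gen (subset_trans IP).
have [t tT PtI] : exists2 t, t \in reflections W S & P \subset t |: I.
  (* If [I] is all of [P], any reflection serves as [t]; otherwise the two bounds leave exactly one
     element of [P] outside [I]. *)
  have [PI|[t]] := set_0Vmem (P :\: I).
    have [s sS] := card_gt0P S0; exists s.
      exact: (subsetP (@simple_sub_reflections _ W S)).
    by rewrite subsetU// orbC -setD_eq0 PI eqxx.
  rewrite inE => /andP[tI tP]; exists t; first exact: (subsetP PT).
  suff /eqP -> : t |: I == P by [].
  rewrite eqEcard subUset sub1set tP IP cardsU1 tI (leq_trans cP)//=.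
  by rewrite add1n -(prednK S0) ltnS.
exists t => //; apply/eqP; rewrite eqEsubset gen_subG subUset sub1set.
rewrite (subsetP (reflections_sub WS))//= W'I.
rewrite gen_subG (subset_trans IP) ?(simple_sub_group WP)//=.
rewrite -{1}PW gen_subG (subset_trans PtI)// subUset sub1set mem_gen ?setU11//=.
by rewrite (subset_trans (subset_gen I))// sub_gen// subsetUr.
Qed.

Local Close Scope ring_scope.
Local Open Scope group_scope.

Theorem corollary6p10 (gT : finGroupType) (W W' : {group gT}) (T : {set gT})
    (n : nat) (n_gt0 : 0 < n)
    (WT : dual_coxeter_system W T n)
    (W'refl : reflection_subgroup T W')
    (W'rank : reflection_subgroup_rank T W' n.-1) :
  parabolic W T W' <-> exists2 t : gT, t \in T & <<t |: W'>> = W.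
Proof.
case: WT => S [_ cS WS TE]; case: W'rank => S' [S'T cS' W'S' TW'].
have {}TE : T = reflections W S by [].
have {}TW' : W' :&: T = reflections W' S' by [].
subst T n; split=> [|[t tT tW]].
  exact: extension_of_parabolic n_gt0 WS W'S' TW' cS'.
apply: (parabolic_of_extension WS _ _ tT _ tW).
- exact: subset_trans S'T (subsetIr _ _).
- by case: W'S'.
- by rewrite cS' prednK.
Qed.
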